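(* Let $\Gamma$ be a digraph or a graph with vertex set $V$. (a) Let $R:V\to\operatorname{Aut}\Gamma$ be a marking of $\Gamma$. Then the right quasigroup $V^\Gamma_R=(V,R)$ realized by $(\Gamma,R)$ is a rack if and only if $R$ is a magma homomorphism from $V^\Gamma_R$ to $\operatorname{Conj}(\operatorname{Aut}\Gamma)$. (b) Let $R:V\to\operatorname{Aut}\Gamma$ be a q-marking of $\Gamma$. Then $V^\Gamma_R$ is a quandle if and only if $R$ is a magma homomorphism from $V^\Gamma_R$ to $\operatorname{Conj}(\operatorname{Aut}\Gamma)$.
   Context: A magma $V_R$ is a pair $(V,R)$ where $V$ is a set and $R$ assigns to each $v\in V$ a function $R_v=R(v):V\to V$. It is a right quasigroup if every $R_v$ is a permutation of $V$. A magma homomorphism $V_R\to W_T$ is a function $\varphi:V\to W$ with $\varphi R_v=T_{\varphi(v)}\varphi$ for all $v\in V$. A right quasigroup $V_R$ is a rack if $R_vR_w=R_{R_v(w)}R_v$ for all $v,w\in V$; a rack is a quandle if $R_v(v)=v$ for all $v\in V$. For a group $G$, $\operatorname{Conj}G$ is the quandle $G_C$ with $C_g(h)=ghg^{-1}$. A digraph is a pair $(V,E)$ with $V$ a set and $E\subseteq V\times V$ (loops allowed). A graph is a simple undirected graph: $E$ is a set of unordered pairs $\{v,w\}\subseteq V$ with $v\ne w$. No finiteness is assumed. $\operatorname{Aut}\Gamma$ is the group of permutations $\varphi$ of $V$ such that both $\varphi$ and $\varphi^{-1}$ send edges to edges. A marking of $\Gamma$ is any function $R:V\to\operatorname{Aut}\Gamma$,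 $v\mapsto R_v$; it is a q-marking if moreover $R_v(v)=v$ for all $v\in V$. The marked (di)graph $(\Gamma,R)$ realizes the right quasigroup $V_R^\Gamma:=(V,R)$. *)

(* Defs.v *)
From HB Require Import structures.
From mathcomp Require Import all_boot.
From mathcomp Require Import boolp classical_sets.

Set Implicit Arguments.
Unset Strict Implicit.
Unset Printing Implicit Defensive.

Local Open Scope group_scope.
Local Open Scope classical_set_scope.

(* MathComp's canonical [magmaType] allows only one operation per carrier.
   Here the same carrier bears many operations ([V] one for each marking, a
   group both its product and conjugation), so magmas are bundled. *)
Record magma := Magma {
  carrier :> Type;
  transl : carrier -> carrier -> carrier
}.

Definition magma_hom (M N : magma) (f : M -> N) : Prop :=
  forall v : M, f \o transl v = transl (f v) \o f.

Record right_quasigroup := RightQuasigroup {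
  rq_magma :> magma;
  transl_bij : forall v : rq_magma, bijective (transl v)
}.

Definition is_rack (Q : right_quasigroup) : Prop :=
  forall v w : Q, transl v \o transl w = transl (transl v w) \o transl v.

Definition is_quandle (Q : right_quasigroup) : Prop :=
  is_rack Q /\ forall v : Q, transl v v = v.

(* MathComp's [h ^ g] is [g^-1 * h * g], the opposite convention. *)
Definition conj_magma (G : groupType) : magma :=
  @Magma G (fun g h => g * h * g^-1).

Lemma conj_transl_bij (G : groupType) (g : conj_magma G) : bijective (transl g).
Proof.
exists (@transl (conj_magma G) (g : G)^-1) => h /=.
  by rewrite invgK !mulgA mulVg mul1g -mulgA mulVg mulg1.
by rewrite invgK !mulgA mulgV mul1g -mulgA mulgV mulg1.
Qed.

Definition Conj (G : groupType) : right_quasigroup :=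
  RightQuasigroup (@conj_transl_bij G).

Lemma Conj_quandle (G : groupType) : is_quandle (Conj G).
Proof.
split=> [v w|v] /=; last by rewrite -mulgA mulgV mulg1.
apply/funext => h /=.
by rewrite !invgM invgK !mulgA -(mulgA _ v^-1 v) mulVg mulg1 -(mulgA _ v^-1 v)
  mulVg mulg1.
Qed.

Record digraph (V : Type) := Digraph { arcs : set (V * V) }.

Record graph (V : Type) := Graph {
  edges : set (set V);
  edgesP : forall e, edges e -> exists v w : V, v <> w /\ e = [set v; w]
}.

Definition digraph_or_graph (V : Type) : Type := (digraph V + graph V)%type.

Definition sends_edges_to_edges (V : Type) (Gamma : digraph_or_graph V)
    (f : V -> V) : Prop :=
  match Gamma with
  | inl D => forall v w, arcs D (v, w) -> arcs D (f v, f w)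
  | inr G => forall e, edges G e -> edges G (f @` e)
  end.

Record permutation (V : Type) := Permutation {
  perm_fun :> V -> V;
  perm_inv : V -> V;
  perm_funK : cancel perm_fun perm_inv;
  perm_invK : cancel perm_inv perm_fun
}.

Record Aut (V : Type) (Gamma : digraph_or_graph V) := MkAut {
  aut_perm :> permutation V;
  aut_fun_edges : sends_edges_to_edges Gamma aut_perm;
  aut_inv_edges : sends_edges_to_edges Gamma (perm_inv aut_perm)
}.

Lemma permutation_eq (V : Type) (s t : permutation V) : s =1 t -> s = t.
Proof.
case: s t => [f f' fK f'K] [g g' gK g'K] /= /funext fg.
rewrite -{}fg {g} in gK g'K *.
have f'g' : f' = g' by apply/funext => x; rewrite -{1}(g'K x) fK.
rewrite -{}f'g' {g'} in gK g'K *.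
by rewrite (Prop_irrelevance gK fK) (Prop_irrelevance g'K f'K).
Qed.

Section AutGroup.
Variables (V : Type) (Gamma : digraph_or_graph V).
Implicit Types f g h : Aut Gamma.

Lemma aut_eq f g : f =1 g -> f = g.
Proof.
case: f g => [s sE s'E] [t tE t'E] /= /permutation_eq st.
rewrite -{}st {t} in tE t'E *.
by rewrite (Prop_irrelevance tE sE) (Prop_irrelevance t'E s'E).
Qed.

Lemma sends_id : sends_edges_to_edges Gamma id.
Proof. by case: Gamma => //= G e eG; rewrite image_id. Qed.

Lemma sends_comp (p q : V -> V) : sends_edges_to_edges Gamma p ->
  sends_edges_to_edges Gamma q -> sends_edges_to_edges Gamma (p \o q).
Proof.
case: Gamma => /= [D pD qD v w /qD /pD //|G pG qG e /qG /pG].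
by rewrite -image_comp.
Qed.

Definition perm_one : permutation V :=
  @Permutation V id id (fun=> erefl) (fun=> erefl).

Definition perm_inverse (s : permutation V) : permutation V :=
  Permutation (@perm_invK V s) (@perm_funK V s).

(* The product is function composition, [(f * g) x = f (g x)], unlike the
   product of MathComp's [{perm T}]. *)
Definition perm_mul (s t : permutation V) : permutation V :=
  Permutation (can_comp (@perm_funK V s) (@perm_funK V t))
              (can_comp (@perm_invK V t) (@perm_invK V s)).

Definition aut_one : Aut Gamma :=
  @MkAut V Gamma perm_one sends_id sends_id.

Definition aut_inv f : Aut Gamma :=
  @MkAut V Gamma (perm_inverse f) (aut_inv_edges f) (aut_fun_edges f).

Definition aut_mul f g : Aut Gamma :=
  @MkAut V Gamma (perm_mul f g)
    (sends_comp (aut_fun_edges f) (aut_fun_edges g))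
    (sends_comp (aut_inv_edges g) (aut_inv_edges f)).

Lemma aut_mulA : associative aut_mul.
Proof. by move=> f g h; apply: aut_eq. Qed.

Lemma aut_mul1g : left_id aut_one aut_mul.
Proof. by move=> f; apply: aut_eq. Qed.

Lemma aut_mulg1 : right_id aut_one aut_mul.
Proof. by move=> f; apply: aut_eq. Qed.

Lemma aut_mulV : left_inverse aut_one aut_inv aut_mul.
Proof. by move=> f; apply: aut_eq => x /=; rewrite perm_funK. Qed.

Lemma aut_Vmul : right_inverse aut_one aut_inv aut_mul.
Proof. by move=> f; apply: aut_eq => x /=; rewrite perm_invK. Qed.

HB.instance Definition _ := gen_eqMixin (Aut Gamma).
HB.instance Definition _ := gen_choiceMixin (Aut Gamma).
HB.instance Definition _ :=
  isGroup.Build (Aut Gamma) aut_mulA aut_mul1g aut_mulg1 aut_mulV aut_Vmul.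

Lemma aut_mulE f g (x : V) : (f * g) x = f (g x).
Proof. by []. Qed.

Lemma aut_invE f : (f^-1 : Aut Gamma) = perm_inv f :> (V -> V).
Proof. by []. Qed.

End AutGroup.

Definition marking (V : Type) (Gamma : digraph_or_graph V) : Type :=
  V -> Aut Gamma.

Definition is_qmarking (V : Type) (Gamma : digraph_or_graph V)
    (R : marking Gamma) : Prop :=
  forall v : V, R v v = v.

Definition realized_magma (V : Type) (Gamma : digraph_or_graph V)
    (R : marking Gamma) : magma :=
  @Magma V (fun v => R v).

Lemma realized_transl_bij (V : Type) (Gamma : digraph_or_graph V)
    (R : marking Gamma) (v : realized_magma R) : bijective (transl v).
Proof. exact: Bijective (@perm_funK V (R v)) (@perm_invK V (R v)). Qed.

Definition realized (V : Type) (Gamma : digraph_or_graph V)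
    (R : marking Gamma) : right_quasigroup :=
  RightQuasigroup (@realized_transl_bij V Gamma R).

(* Main.v *)
(* Composed on the right with [R v], the conjugation identity
   [R (R v w) = R v * R w * (R v)^-1] becomes the rack identity
   [R v \o R w = R (R v w) \o R v], and conversely because [R v] is
   invertible. *)
Require Import Defs.
From HB Require Import structures.
From mathcomp Require Import all_boot.
From mathcomp Require Import boolp.

Lemma realized_rackP (V : Type) (Gamma : digraph_or_graph V)
    (R : marking Gamma) :
  is_rack (realized R) <->
  magma_hom (M := realized R) (N := Conj (Aut Gamma)) R.
Proof.
split=> [rackR v|homR v w]; apply/funext.
  move=> w; apply: aut_eq => x /=.
  (* The point [perm_inv (R v) x] is chosen so that the trailing [R v] in the rack identity cancels,
     leaving [R (R v w)] at [x] itself. *)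
  have /= := congr1 (fun f => f (perm_inv (R v) x)) (rackR v w).
  by rewrite perm_invK => ->.
move=> x /=.
(* This equates automorphisms, so it can be rewritten under application to [R v x], where [(R v)^-1]
   cancels. *)
have /= -> := congr1 (fun f => f w) (homR v).
by rewrite !aut_mulE aut_invE perm_funK.
Qed.

Theorem theorem1p3 (V : Type) (Gamma : digraph_or_graph V) :
  (forall R : marking Gamma,
     is_rack (realized R) <->
     magma_hom (M := realized R) (N := Conj (Aut Gamma)) R) /\
  (forall R : marking Gamma, is_qmarking R ->
     (is_quandle (realized R) <->
      magma_hom (M := realized R) (N := Conj (Aut Gamma)) R)).
Proof.
split=> [R|R qR]; first exact: realized_rackP.
(* The idempotence half of [is_quandle] unfolds to [qR], so only the rack half is at stake. *)
by split=> [[/realized_rackP]|/realized_rackP].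
Qed.
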